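(* Let $T,K\in\mathbb{N}$ with $T\geq 1$ and $K\geq 2$. Let $\beta>0$ and $\varepsilon>0$ be real numbers, let $\gamma$ be a nonzero real number, and let $g:\mathbb{Z}\times\mathbb{C}\to\mathbb{C}$ be continuous. Suppose that $g$ is $T$-periodic in its first variable, i.e. $g(t+T,z)=g(t,z)$ for all $(t,z)\in\mathbb{Z}\times\mathbb{C}$. If $$\lim_{|z|\to\infty}\frac{g(t,z)}{|z|^3}=0\quad\text{for each } t\in\mathbb{Z},$$ then the discrete nonlinear Schrödinger equation $$i\beta(\Delta_t+\nabla_t)\phi(t,k)+\gamma|\phi(t,k)|^2\phi(t,k)+\varepsilon\Delta_k^2\phi(t,k-1)=g(t,\phi(t,k)),\qquad (t,k)\in\mathbb{Z}\times\mathbb{Z},$$ has a $(T,K)$-periodic solution $\phi:\mathbb{Z}\times\mathbb{Z}\to\mathbb{C}$.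
   Context: Here $i$ is the complex imaginary unit and $|\cdot|$ is the Euclidean norm (modulus) on $\mathbb{C}$. For $\phi:\mathbb{Z}\times\mathbb{Z}\to\mathbb{C}$, the difference operators are $$(\Delta_t\phi)(t,k)=\phi(t+1,k)-\phi(t,k),\qquad (\nabla_t\phi)(t,k)=\phi(t,k)-\phi(t-1,k),$$ $$(\Delta_k\phi)(t,k)=\phi(t,k+1)-\phi(t,k),$$ so that $(\Delta_t+\nabla_t)\phi(t,k)=\phi(t+1,k)-\phi(t-1,k)$ and $\Delta_k^2\phi(t,k-1)=\phi(t,k+1)-2\phi(t,k)+\phi(t,k-1)$. A function $\phi:\mathbb{Z}\times\mathbb{Z}\to\mathbb{C}$ is called $(T,K)$-periodic if $\phi(t+T,k)=\phi(t,k)$ and $\phi(t,k+K)=\phi(t,k)$ for all $t,k\in\mathbb{Z}$. Continuity of $g:\mathbb{Z}\times\mathbb{C}\to\mathbb{C}$ is with respect to the discrete topology on $\mathbb{Z}$, i.e. $g(t,\cdot)$ is continuous on $\mathbb{C}$ for each $t\in\mathbb{Z}$. *)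

(* Defs.v *)
From Stdlib Require Export Reals ZArith.
From Coquelicot Require Export Coquelicot.
From Stdlib Require Import Lra.

Open Scope C_scope.

Definition Delta_t (phi : Z -> Z -> C) : Z -> Z -> C :=
  fun t k => phi (t + 1)%Z k - phi t k.

Definition nabla_t (phi : Z -> Z -> C) : Z -> Z -> C :=
  fun t k => phi t k - phi (t - 1)%Z k.

Definition Delta_k (phi : Z -> Z -> C) : Z -> Z -> C :=
  fun t k => phi t (k + 1)%Z - phi t k.

Definition periodic2 (T K : nat) (phi : Z -> Z -> C) : Prop :=
  forall t k : Z,
    phi (t + Z.of_nat T)%Z k = phi t k /\ phi t (k + Z.of_nat K)%Z = phi t k.

(** The neighbourhoods of infinity in the plane, i.e. the filter
    [|z| -> infinity]. *)
Definition Cmod_infty : (C -> Prop) -> Prop :=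
  fun P => exists M : R, forall z : C, (M < Cmod z)%R -> P z.

#[export] Instance Cmod_infty_ProperFilter : ProperFilter Cmod_infty.
Proof.
  constructor.
  - intros P [M HM].
    exists (RtoC (Rabs M + 1)). apply HM.
    rewrite Cmod_R.
    pose proof (Rle_abs M). pose proof (Rabs_pos M).
    rewrite Rabs_pos_eq; lra.
  - constructor.
    + exists 0%R. intros z _. exact I.
    + intros P Q [M HM] [N HN]. exists (Rmax M N).
      intros z Hz. pose proof (Rmax_l M N). pose proof (Rmax_r M N).
      split; [apply HM | apply HN]; lra.
    + intros P Q HPQ [M HM]. exists M. intros z Hz. apply HPQ, HM, Hz.
Qed.

(* Main.v *)
Require Import Defs.
From Stdlib Require Import Reals ZArith Lra Lia Classical IndefiniteDescription.
From Coquelicot Require Import Coquelicot.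
From mathcomp Require all_boot all_fingroup zify.

Open Scope C_scope.

(** Multiply the equation by [gamma] and move everything to one side. A
    [(T,K)]-periodic field is a vector of [2TK] real numbers (the real and
    imaginary parts at the sites of one period), and a solution is a zero of a
    continuous map of this space into itself. At each site the value of that map
    is [gamma^2 |z|^2 z], with [z] the field at the site, plus the contribution of
    the linear terms and of [g]. Fix a large [r] and let all coordinates lie in
    [[-r, r]]. When the real or imaginary part of [z] at a site equals [r] or
    [-r], the cubic term has that part at least [gamma^2 |z|^2 r] in absolute
    value, with the same sign. The linear terms are of order [r], the neighbours
    being bounded by [2r], and [g] is at most a small multiple of
    [|z|^3 <= 2r |z|^2], because [|z| >= r] is large. So on every face of the cube
    [[-r, r]^(2TK)] the coordinate belonging to that face points outwards, and the
    Poincare-Miranda theorem gives a zero. As [g] is merely continuous, a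
    topological argument of this kind is natural: the equation need not be
    variational.

    The Poincare-Miranda theorem ([Miranda.poincare_miranda]) is proved through
    Kuhn's cubical version of Sperner's lemma ([Kuhn.kuhn_cell]). A fine grid on
    the cube is labelled by the first coordinate of the map that is negative (the
    label is one past the last coordinate when there is none), with the
    obvious correction on the faces. Some cell carries all labels, so that every
    coordinate of the map is both nonpositive and nonnegative somewhere in a tiny
    cell; by compactness a map without zeros would have, around each point, a
    coordinate of constant strict sign, uniformly on all small cells.

    Kuhn's lemma is a parity argument by induction on the dimension. In the
    Freudenthal triangulation of the grid, the facets carrying the labels
    [0, ..., m] of the [(m+1)]-dimensional cells are counted modulo 2 in two ways:
    cell by cell ([Kuhn.odd_doors_full]), and by cancelling each interior facet
    against itself seen from the other side ([Kuhn.odd_doors_face]). *)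

(** * Kuhn's cubical Sperner lemma *)

Module Kuhn.
Import all_boot all_fingroup zify.
Set Implicit Arguments. Unset Strict Implicit. Unset Printing Implicit Defensive.
Local Open Scope nat_scope.

Ltac ifs_lia := repeat case: ifP; lia.

Lemma odd_bigsum (I : finType) (f : I -> nat) :
  odd (\sum_i f i) = odd (\sum_i odd (f i)).
Proof.
by rewrite !(big_morph odd oddD (erefl : odd 0 = false)); apply: eq_bigr => i _; rewrite oddb.
Qed.

Lemma even_involution (T : finType) (f : T -> T) (A : {set T}) :
  {in A, forall x, f x \in A} -> {in A, forall x, f (f x) = x} ->
  {in A, forall x, f x != x} -> ~~ odd #|A|.
Proof.
have [k] := ubnP #|A|; elim: k A => // k IH A; rewrite ltnS => leA fA ffA fxA.
have [->|[x xA]] := set_0Vmem A; first by rewrite cards0.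
have fx := fA _ xA; have nx := fxA _ xA.
have fxD : f x \in A :\ x by rewrite !inE nx.
rewrite (cardsD1 x) xA (cardsD1 (f x)) fxD /= negbK.
move: leA; rewrite (cardsD1 x) xA (cardsD1 (f x)) fxD => leA.
apply: IH => [|y|y|y]; first by lia.
- rewrite !inE => /and3P[y1 y2 yA]; rewrite fA // andbT.
  apply/andP; split; apply/eqP => e.
    by move: y2; rewrite -(ffA y) // e ffA ?eqxx.
  by move: y1; rewrite -(ffA y) // e eqxx.
- by rewrite !inE => /and3P[_ _ yA]; apply: ffA.
- by rewrite !inE => /and3P[_ _ yA]; apply: fxA.
Qed.

Lemma perm_eq_omit (m : nat) (f : nat -> nat) (j : nat) s : j < m ->
  perm_eq (mkseq f m) (f j :: s) =
  perm_eq [seq f k | k <- iota 0 m & k != j] s.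
Proof.
move=> jm; have jI : j \in iota 0 m by rewrite mem_iota.
have /(perm_map f)/permPl -> := perm_to_rem jI.
by rewrite /= perm_cons (rem_filter _ (iota_uniq _ _)).
Qed.

(** If the labels other than the one at [j] are [0, ..., m], then another index
    [j'] has this property exactly when [f j' = f j]. So there are two such
    indices if [f j <= m] and a single one if [f j = m.+1]. *)
Lemma odd_doors (m : nat) (f : nat -> nat) :
  (forall k, k < m.+2 -> f k <= m.+1) ->
  odd #|[set j : 'I_m.+2 | perm_eq (mkseq f m.+2) (f j :: iota 0 m.+1)]| =
  perm_eq (mkseq f m.+2) (iota 0 m.+2).
Proof.
move=> fle; set D := [set j | _].
have iotaS : perm_eq (iota 0 m.+2) (m.+1 :: iota 0 m.+1).
  rewrite -[m.+2]addn1 (iotaD 0 m.+1 1) cats1 add0n.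
  by rewrite perm_rcons perm_refl.
have [D0|[j jD]] := set_0Vmem D.
  rewrite D0 cards0 /=; symmetry; apply/negbTE/negP => full.
  have : m.+1 \in mkseq f m.+2 by rewrite (perm_mem full) (mem_iota 0 m.+2) leq0n ltnSn.
  case/mapP => j; rewrite (mem_iota 0 m.+2) => jm ej.
  suff : Ordinal jm \in D by rewrite D0 inE.
  by rewrite inE /= -ej; apply: perm_trans full iotaS.
move: jD; rewrite inE => jD.
have -> : #|D| = count_mem (f j) (f j :: iota 0 m.+1).
  rewrite -(seq.permP jD) /mkseq -val_enum_ord -map_comp count_map.
  rewrite -sum1_card -sum1_count big_enum_cond; apply: eq_bigl => i /=.
  rewrite inE (permPl jD) -(cat1s (f j)) -(cat1s (f i)) perm_cat2r.
  by apply/idP/eqP => [/perm_mem/(_ (f i))|->];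
    rewrite ?perm_refl // !inE eqxx => /eqP.
have -> : perm_eq (mkseq f m.+2) (iota 0 m.+2) = (f j == m.+1).
  rewrite (permPl jD) (permPr iotaS) -(cat1s (f j)) -(cat1s m.+1) perm_cat2r.
  by apply/idP/eqP => [/perm_mem/(_ (f j))|->]; 
    rewrite ?perm_refl // !inE eqxx; move/esym/eqP.
have -> : count_mem (f j) (f j :: iota 0 m.+1) = 1 + (f j <= m).
  by rewrite -cat1s count_cat (count_uniq_mem _ (iota_uniq _ _)) (mem_iota 0 m.+1) /= eqxx.
by have := fle _ (ltn_ord j); case: ltngtP; lia.
Qed.

Section Cells.
Variables n N : nat.

Definition point := {ffun 'I_n.+1 -> nat}.
(** A cell [(p, r)] is a simplex of the Freudenthal triangulation: walk from the
    corner [p] of a unit cube to the opposite corner, raising coordinate [i] by one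
    at step number [r i]. Its vertices are the points visited, the [j]-th being
    reached after [j] steps. *)
Definition cell := ({ffun 'I_n.+1 -> 'I_N.+1} * {perm 'I_n.+1})%type.

Definition vertex (s : cell) (j : nat) : point :=
  [ffun i => s.1 i + (s.2 i < j)].

(** These cells triangulate the [m]-dimensional face on which the coordinates from
    [m] on vanish, if only their vertices [0, ..., m] are looked at: the remaining
    steps come last, in a fixed order. This lets all dimensions live in a single
    type. *)
Definition flat (m : nat) (s : cell) : bool :=
  [forall i : 'I_n.+1, (m <= i) ==> (s.1 i == 0 :> nat) && (s.2 i == i)].

Lemma flatP m (s : cell) :
  reflect (forall i : 'I_n.+1, m <= i -> s.1 i = 0 :> nat /\ s.2 i = i) (flat m s).
Proof.
apply: (iffP forallP) => [H i mi | H i]; last first.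
  by apply/implyP => /H[-> ->]; rewrite !eqxx.
by have /implyP/(_ mi)/andP[/eqP-> /eqP->] := H i.
Qed.

Lemma perm_lt_flat m (s : cell) (i : 'I_n.+1) : flat m s -> (s.2 i < m) = (i < m).
Proof.
move=> /flatP fl; case: (ltnP i m) => [im|mi]; last by have [_ ->] := fl _ mi; lia.
case: ltnP => // mi; have [_ /perm_inj e] := fl _ mi; move: mi; rewrite e; lia.
Qed.

Section Rotation.
Variable m : nat.
Hypothesis mn : m <= n.

Definition rot_up_fun (k : 'I_n.+1) : 'I_n.+1 :=
  inord (if k == m :> nat then 0 else if k < m then k.+1 else k).
Definition rot_down_fun (k : 'I_n.+1) : 'I_n.+1 :=
  inord (if k == 0 :> nat then m else if k <= m then k.-1 else k).

Lemma val_rot_up k :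
  rot_up_fun k = (if k == m :> nat then 0 else if k < m then k.+1 else k) :> nat.
Proof. by rewrite inordK //; have := ltn_ord k; ifs_lia. Qed.

Lemma val_rot_down k :
  rot_down_fun k = (if k == 0 :> nat then m else if k <= m then k.-1 else k) :> nat.
Proof. by rewrite inordK //; have := ltn_ord k; ifs_lia. Qed.

Lemma rot_upK : cancel rot_up_fun rot_down_fun.
Proof.
by move=> k; apply: ord_inj; rewrite /= val_rot_down val_rot_up; ifs_lia.
Qed.

Lemma rot_downK : cancel rot_down_fun rot_up_fun.
Proof.
by move=> k; apply: ord_inj; rewrite /= val_rot_up val_rot_down; ifs_lia.
Qed.

Definition rot_up : {perm 'I_n.+1} := perm (can_inj rot_upK).
Definition rot_down : {perm 'I_n.+1} := perm (can_inj rot_downK).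

(** The cell on the other side of the facet opposite vertex [j], together with the
    number of its vertex that is not on this facet. For an inner [j], the steps
    before and after vertex [j] are exchanged. For the first vertex, the first step
    is postponed to the end, which moves the corner of the cube; for the last
    vertex it is the other way round. *)
Definition pivot (x : cell * 'I_m.+2) : cell * 'I_m.+2 :=
  let: (s, j) := x in
  if j == 0 :> nat then
    ([ffun i => inord (s.1 i + (s.2 i == 0 :> nat))], (s.2 * rot_down)%g, ord_max)
  else if j == m.+1 :> nat then
    ([ffun i => inord (s.1 i - (s.2 i == m :> nat))], (s.2 * rot_up)%g, ord0)
  else (s.1, (s.2 * tperm (inord j.-1) (inord j))%g, j).

(** The facet opposite vertex [j] lies on the boundary of the grid, so that
    [pivot] would leave it. *)
Definition outward (x : cell * 'I_m.+2) : bool :=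
  let: (s, j) := x in
  (j == 0 :> nat) && [exists i, (s.2 i == 0 :> nat) && (s.1 i == N :> nat)]
  || (j == m.+1 :> nat) && [exists i, (s.2 i == m :> nat) && (s.1 i == 0 :> nat)].

Lemma pivot_neq x : pivot x != x.
Proof.
case: x => [[p r] j] /=; apply/eqP; case: ifP => [/eqP j0|/eqP j0].
  by case=> _ _ /(congr1 val) /=; lia.
case: ifP => [/eqP jm|/eqP jm]; first by case=> _ _ /(congr1 val) /=; lia.
case=> /(congr1 (fun q => r^-1 * q)%g); rewrite mulKg mulVg.
move=> /permP/(_ (inord j))/(congr1 val); rewrite tpermR perm1 /=.
by have jlt := ltn_ord j; rewrite !inordK; lia.
Qed.

Lemma outwardPn (s : cell) (j : 'I_m.+2) :
  ~~ outward (s, j) ->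
  (j = 0 :> nat -> forall i, s.2 i = 0 :> nat -> s.1 i < N) /\
  (j = m.+1 :> nat -> forall i, s.2 i = m :> nat -> 0 < s.1 i).
Proof.
case: s => p r; rewrite /outward negb_or => /andP[out0 outm]; split=> jE i ri.
  move: out0; rewrite jE eqxx /= => /existsPn/(_ i); rewrite ri eqxx /= => pN.
  by have := ltn_ord (p i); lia.
by move: outm; rewrite jE eqxx /= => /existsPn/(_ i); rewrite ri eqxx /= lt0n.
Qed.

Lemma val_shift_up (p : {ffun 'I_n.+1 -> 'I_N.+1}) (b : bool) i :
  (b -> p i < N) -> (inord (p i + b) : 'I_N.+1) = p i + b :> nat.
Proof. by move=> H; rewrite inordK //; have := ltn_ord (p i); case: b H => [/(_ isT)|_]; lia. Qed.

Lemma val_shift_down (p : {ffun 'I_n.+1 -> 'I_N.+1}) (b : bool) i :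
  (inord (p i - b) : 'I_N.+1) = p i - b :> nat.
Proof. by rewrite inordK //; have := ltn_ord (p i); lia. Qed.

Lemma pivot_first (s : cell) : ~~ outward (s, ord0) ->
  forall k, k <= m -> vertex (pivot (s, ord0)).1 k = vertex s k.+1.
Proof.
case: s => p r /outwardPn[/(_ erefl) /= lo _] k km.
apply/ffunP => i; rewrite !ffunE /= val_shift_up => [|/eqP/lo//].
by rewrite permM permE val_rot_down; ifs_lia.
Qed.

Lemma pivot_last (s : cell) : ~~ outward (s, ord_max) ->
  forall k, k <= m -> vertex (pivot (s, ord_max)).1 k.+1 = vertex s k.
Proof.
case: s => p r /outwardPn[_ /(_ erefl) /= lo] k km.
rewrite eqxx; apply/ffunP => i; rewrite !ffunE /= val_shift_down.
by have := lo i; rewrite permM permE val_rot_up; ifs_lia.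
Qed.

Lemma pivot_inner (s : cell) (j : 'I_m.+2) : 0 < j < m.+1 ->
  forall k : nat, k != j -> vertex (pivot (s, j)).1 k = vertex s k.
Proof.
case: s => p r jm k kj; rewrite /pivot !ifF; [|lia|lia].
apply/ffunP => i; rewrite !ffunE /= permM.
have v1 : (inord j.-1 : 'I_n.+1) = j.-1 :> nat by rewrite inordK; lia.
have v2 : (inord j : 'I_n.+1) = j :> nat by rewrite inordK; lia.
by case: tpermP => [->|->|_ _]; rewrite ?v1 ?v2; lia.
Qed.

Lemma pivot_flat x : ~~ outward x -> flat m.+1 x.1 -> flat m.+1 (pivot x).1.
Proof.
case: x => [[p r] j] /outwardPn /= [lo hi] /flatP fl.
apply/flatP => i mi; have /= [p0 ri] := fl i mi.
case: ifP => [j0|j0] /=.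
  rewrite ffunE ri val_shift_up; last by lia.
  by rewrite p0; split; first lia; apply: ord_inj; rewrite permM permE val_rot_down ri; ifs_lia.
case: ifP => [jm|jm] /=; last first.
  split=> //; rewrite permM ri tpermD // -val_eqE /= inordK; have := ltn_ord j; lia.
rewrite ffunE ri val_shift_down p0.
by split; first lia; apply: ord_inj; rewrite permM permE val_rot_up ri; ifs_lia.
Qed.

Lemma pivot_outward x : ~~ outward x -> ~~ outward (pivot x).
Proof.
case: x => [[p r] j] /outwardPn /= [lo hi].
case: ifP => [j0|j0] /=.
  rewrite eqxx /=; apply/existsPn => i; rewrite permM permE val_rot_down ffunE.
  by rewrite val_shift_up => [|/eqP]; [have := ltn_ord (r i); ifs_lia|apply: lo; lia].
case: ifP => [jm|jm] /=.
  rewrite orbF; apply/existsPn => i; rewrite permM permE val_rot_up ffunE.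
  rewrite val_shift_down; have := hi _ i; have := ltn_ord (p i); ifs_lia.
by rewrite j0 jm.
Qed.

Lemma pivotK x : ~~ outward x -> pivot (pivot x) = x.
Proof.
case: x => [[p r] j] /outwardPn /= [lo hi].
case: ifP => [/eqP j0|j0] /=.
  rewrite eqxx; congr (_, _, _); last exact: ord_inj.
    apply/ffunP => i; apply: ord_inj; rewrite ffunE /= val_shift_down ffunE.
    rewrite val_shift_up => [|/eqP]; last by apply: lo; lia.
    by rewrite permM permE val_rot_down; ifs_lia.
  by apply/permP => i; rewrite !permM !permE rot_downK.
case: ifP => [/eqP jm|jm] /=.
  congr (_, _, _); last exact: ord_inj.
    apply/ffunP => i; apply: ord_inj; have := hi jm i; have := ltn_ord (p i).
    rewrite ffunE /= => pN pi.
    rewrite val_shift_up ffunE val_shift_down permM permE val_rot_up; ifs_lia.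
  by apply/permP => i; rewrite !permM !permE rot_upK.
by rewrite j0 jm -mulgA tperm2 mulg1.
Qed.
End Rotation.

Section Labelling.
Variable lam : point -> nat.
Hypothesis lam_le : forall v, lam v <= n.+1.
Hypothesis lam_low : forall (v : point) (i : 'I_n.+1), v i = 0 -> lam v <= i.
Hypothesis lam_high : forall (v : point) (i : 'I_n.+1), v i = N.+1 -> lam v != i.

Definition full m (s : cell) : bool :=
  flat m s && perm_eq (mkseq (fun k => lam (vertex s k)) m.+1) (iota 0 m.+1).

(** The facet opposite vertex [x.2] has the labels [0, ..., m]. Adding the label at
    that vertex to both sides avoids deleting it from the list of labels, and shows
    that being a door depends only on the cell and on this one label. *)
Definition door m (x : cell * 'I_m.+2) : bool :=
  flat m.+1 x.1 &&
  perm_eq (mkseq (fun k => lam (vertex x.1 k)) m.+2)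
          (lam (vertex x.1 x.2) :: iota 0 m.+1).

Lemma omit_first m : [seq k <- iota 0 m.+2 | k != 0] = iota 1 m.+1.
Proof.
transitivity [seq k <- iota 1 m.+1 | k != 0]; first by [].
by apply/all_filterP/allP => k; rewrite (mem_iota 1 m.+1); lia.
Qed.

Lemma omit_last m : [seq k <- iota 0 m.+2 | k != m.+1] = iota 0 m.+1.
Proof.
rewrite -[m.+2]addn1 (iotaD 0 m.+1 1) filter_cat.
have -> : [seq k <- iota (0 + m.+1) 1 | k != m.+1] = [::] by rewrite /= eqxx.
by rewrite cats0; apply/all_filterP/allP => k; rewrite (mem_iota 0 m.+1); lia.
Qed.

Lemma door_omit m (s : cell) (j : 'I_m.+2) :
  door (s, j) = flat m.+1 s &&
    perm_eq [seq lam (vertex s k) | k <- iota 0 m.+2 & k != j :> nat] (iota 0 m.+1).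
Proof. by rewrite /door (@perm_eq_omit _ (fun k => lam (vertex s k))). Qed.

Lemma door_first m (s : cell) :
  door (s, ord0 : 'I_m.+2) = flat m.+1 s &&
    perm_eq [seq lam (vertex s k.+1) | k <- iota 0 m.+1] (iota 0 m.+1).
Proof.
by rewrite door_omit omit_first (iotaDl 1 0 m.+1) -map_comp.
Qed.

Lemma door_last m (s : cell) :
  door (s, ord_max : 'I_m.+2) = flat m.+1 s &&
    perm_eq [seq lam (vertex s k) | k <- iota 0 m.+1] (iota 0 m.+1).
Proof. by rewrite door_omit omit_last. Qed.

Lemma pivot_door m (mn : m <= n) (x : cell * 'I_m.+2) :
  ~~ outward x -> door x -> door (pivot mn x).
Proof.
case: x => s j out dx.
have fl : flat m.+1 (pivot mn (s, j)).1.
  by apply: pivot_flat out _; case/andP: dx.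
have [j0|j0] := eqVneq j ord0.
  move: dx fl; subst j; rewrite door_first => /andP[_ dx] fl.
  have -> : pivot mn (s, ord0) = ((pivot mn (s, ord0)).1, ord_max) by case: (s).
  rewrite door_last fl; apply: etrans dx; congr perm_eq.
  apply/eq_in_map => k; rewrite (mem_iota 0 m.+1) => km.
  by rewrite pivot_first //; lia.
have [jm|jm] := eqVneq j ord_max.
  move: dx fl; subst j; rewrite door_last => /andP[_ dx] fl.
  have -> : pivot mn (s, ord_max) = ((pivot mn (s, ord_max)).1, ord0).
    by case: (s) => p r; rewrite /= eqxx.
  rewrite door_first fl; apply: etrans dx; congr perm_eq.
  apply/eq_in_map => k; rewrite (mem_iota 0 m.+1) => km.
  by rewrite pivot_last //; lia.
have j0' : j != 0 :> nat := j0.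
have jm' : j != m.+1 :> nat := jm.
have -> : pivot mn (s, j) = ((pivot mn (s, j)).1, j).
  by case: (s) => p r; rewrite /= (negbTE j0') (negbTE jm').
move: dx; rewrite !door_omit fl => /andP[_ dx]; apply: etrans dx; congr perm_eq.
apply/eq_in_map => k; rewrite mem_filter => /andP[kj _].
by rewrite pivot_inner //; have := ltn_ord j; lia.
Qed.

Lemma flatS m (s : cell) : flat m s -> flat m.+1 s.
Proof. by move=> /flatP fl; apply/flatP => i mi; apply: fl; lia. Qed.

(** On a face where coordinate [i] is maximal the label [i] is missing, and on a
    face where it is zero all labels are at most [i]. So a boundary facet with all
    of the labels [0, ..., m] lies where coordinate [m] is zero, and there it is a
    full cell of one dimension less. *)
Lemma outward_door m (mn : m <= n) (x : cell * 'I_m.+2) :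
  door x && outward x = (x.2 == ord_max) && full m x.1.
Proof.
case: x => s j /=; apply/andP/andP.
  case=> dx /orP[]/andP[/eqP jE /existsP[i /andP[/eqP ri /eqP pi]]].
    have j0 : j = ord0 by apply: ord_inj.
    move: dx; rewrite j0 door_first => /andP[fl /perm_mem/(_ (i : nat))].
    rewrite (mem_iota 0 m.+1) -(perm_lt_flat i fl) ri => /mapP[k _ ik].
    have := @lam_high (vertex s k.+1) i; rewrite -ik eqxx !ffunE ri pi.
    by move/(_ (addn1 N)).
  have jm : j = ord_max by apply: ord_inj.
  split; first by rewrite jm.
  move: dx; rewrite jm door_last => /andP[fl perm_lab].
  rewrite /full [X in _ && X]perm_lab andbT.
  have im : i < m.+1 by rewrite -(perm_lt_flat i fl) ri.
  have mi : m <= i.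
    have := perm_mem perm_lab m; rewrite (mem_iota 0 m.+1) ltnSn => /mapP[k].
    rewrite (mem_iota 0 m.+1) => km ->; apply: lam_low.
    by rewrite !ffunE ri pi; lia.
  apply/flatP => i' mi'; have [e|ne] := eqVneq i' i.
    by rewrite e pi; split=> //; apply: ord_inj; lia.
  by move/flatP: fl; apply; move: ne; rewrite -val_eqE /=; lia.
case=> /eqP -> /andP[fl perm_lab]; rewrite door_last (flatS fl) perm_lab.
split=> //; apply/orP; right; rewrite eqxx /=; apply/existsP; exists (inord m).
have mE : (inord m : 'I_n.+1) = m :> nat by rewrite inordK.
by have /flatP/(_ (inord m)) := fl; rewrite mE => /(_ (leqnn m))[-> ->]; rewrite mE !eqxx.
Qed.

(** The vertices of a flat cell have coordinate [m] equal to zero, unless [m] is the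
    full dimension. *)
Lemma lam_vertex_le m (s : cell) k : m <= n.+1 -> flat m s -> k <= m -> lam (vertex s k) <= m.
Proof.
rewrite leq_eqVlt => /orP[/eqP->//|mn] /flatP fl km.
have mE : (inord m : 'I_n.+1) = m :> nat by rewrite inordK.
rewrite -[X in _ <= X]mE; apply: lam_low.
by have := fl (inord m); rewrite ffunE mE => /(_ (leqnn m))[-> ->]; rewrite mE; lia.
Qed.

Lemma odd_doors_full m : m <= n ->
  odd #|[set x | @door m x]| = odd #|[set s | full m.+1 s]|.
Proof.
move=> mn.
have -> : #|[set x | @door m x]| = \sum_s #|[set j : 'I_m.+2 | door (s, j)]|.
  rewrite -sum1_card (eq_bigl (fun x : cell * 'I_m.+2 => xpredT x.1 && door (x.1, x.2))).
    rewrite -(pair_big_dep xpredT (fun s (j : 'I_m.+2) => door (s, j)) (fun _ _ => 1)) /=.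
    by apply: eq_bigr => s _; rewrite -sum1_card; apply: eq_bigl => j; rewrite inE.
  by case=> s j; rewrite inE.
rewrite odd_bigsum -sum1_card [in RHS]big_mkcond; congr odd.
apply: eq_bigr => s _; rewrite inE /full.
case fl: (flat m.+1 s) => /=; last first.
  by rewrite (_ : [set j | _] = set0) ?cards0 //; apply/setP => j; rewrite !inE /door fl.
rewrite -(@odd_doors _ (fun k => lam (vertex s k))); last first.
  by move=> k km; apply: lam_vertex_le.
congr (nat_of_bool (odd _)); apply: eq_card => j; by rewrite !inE /door fl.
Qed.

(** Doors that are not on the boundary cancel in pairs under [pivot]. *)
Lemma odd_doors_face m : m <= n ->
  odd #|[set x | @door m x]| = odd #|[set s | full m s]|.
Proof.
move=> mn; rewrite -(cardsID [set x | outward x]) oddD.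
rewrite [X in _ (+) X](negbTE _) ?addbF; last first.
  apply: (@even_involution _ (pivot mn)) => x; rewrite !inE => /andP[out dx].
  - by rewrite pivot_outward // pivot_door.
  - exact: pivotK.
  - exact: pivot_neq.
rewrite -(card_imset _ (_ : injective (fun s : cell => (s, ord_max : 'I_m.+2)))) //.
  congr odd; apply: eq_card => x; rewrite !inE outward_door //.
  apply/andP/imsetP => [[/eqP jm fx]|[s]].
    by exists x.1; rewrite ?inE //; case: x jm {fx} => s j /= ->.
  by rewrite inE => fs ->.
by move=> s s' [].
Qed.

Lemma odd_full m : m <= n.+1 -> odd #|[set s | full m s]|.
Proof.
elim: m => [_|m IH mn]; last by rewrite -odd_doors_full // odd_doors_face // IH // ltnW.
rewrite (_ : [set s | _] = [set ([ffun => ord0], 1%g)]) ?cards1 //.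
apply/setP => -[p r]; rewrite !inE; apply/andP/eqP => [[/flatP fl _]|[-> ->]].
  congr pair; first by apply/ffunP => i; apply: ord_inj; rewrite ffunE; case: (fl i).
  by apply/permP => i; rewrite perm1; case: (fl i).
have fl : flat 0 ([ffun => ord0], 1%g).
  by apply/flatP => i _; rewrite ffunE perm1.
split=> //; rewrite /= /mkseq /=.
by have := lam_vertex_le (leq0n _) fl (leqnn 0); case: (lam _).
Qed.

(** The labels in question are only asked to be found within one unit cube, which
    is all that remains of the triangulation in later arguments. *)
Lemma kuhn_cell : exists p : {ffun 'I_n.+1 -> 'I_N.+1},
  forall l, l <= n.+1 -> exists2 v : point, lam v = l & forall i, p i <= v i <= (p i).+1.
Proof.
have : 0 < #|[set s | full n.+1 s]| by apply: odd_gt0; apply: odd_full.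
case/card_gt0P => s; rewrite inE => /andP[_ fs]; exists s.1 => l ln.
have := perm_mem fs l; rewrite (mem_iota 0 n.+2) ltnS ln => /mapP[k _ ->].
by exists (vertex s k) => // i; rewrite ffunE; case: (_ < k); rewrite ?addn1 ?addn0 leqnn leqnSn.
Qed.

End Labelling.
End Cells.
End Kuhn.

(** * The Poincare-Miranda theorem *)

Module Miranda.
Import all_boot zify.
Delimit Scope R_scope with R.
Set Implicit Arguments. Unset Strict Implicit. Unset Printing Implicit Defensive.
Local Open Scope nat_scope.

Fixpoint coord (n : nat) : Compactness.Tn n R -> nat -> R :=
  match n with
  | 0 => fun _ _ => 0%R
  | n'.+1 => fun t i => if i is i'.+1 then coord (snd t) i' else fst t
  end.

Fixpoint vec (n : nat) (f : nat -> R) : Compactness.Tn n R :=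
  match n with
  | 0 => tt
  | n'.+1 => (f 0, vec n' (fun i => f i.+1))
  end.

Lemma coord_vec n f i : i < n -> coord (vec n f) i = f i.
Proof. by elim: n f i => [|n IH] f [|i] //= lt_in; rewrite IH. Qed.

Lemma bounded_coord n (a b : R) (t : Compactness.Tn n R) :
  bounded_n n (vec n (fun=> a)) (vec n (fun=> b)) t <->
  (forall i, i < n -> (a <= coord t i <= b)%R).
Proof.
elim: n t => [|n IH] /= => [[]|[x t]]; first by split.
split=> [[xab /IH tab] [|i]|H]; [by []|exact: tab|].
by split; [exact: (H 0) | apply/IH => i; exact: (H i.+1)].
Qed.

Lemma close_coord n (d : R) (s t : Compactness.Tn n R) :
  close_n n d s t -> forall i, i < n -> (Rabs (coord s i - coord t i) < d)%R.
Proof.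
elim: n s t => [|n IH] //= [x s] [y t] [xy /IH st] [|i] //; exact: st.
Qed.

Definition in_cube (I : Type) (r : R) (x : I -> R) : Prop :=
  forall i, (- r <= x i <= r)%R.

(** A Lebesgue number for the cover of the cube by balls on which [P] holds: every
    point lies in one of these balls, with a radius bounded below uniformly. *)
Lemma lebesgue_number n (r : R) (P : ('I_n -> R) -> posreal -> Prop) :
  (forall x, in_cube r x -> exists d, P x d) ->
  exists d : posreal, forall x, in_cube r x ->
    exists (t : 'I_n -> R) (e : posreal),
      [/\ P t e, (forall i, (Rabs (x i - t i) < e)%R) & (d <= e)%R].
Proof.
move=> locP; pose fam (t : Compactness.Tn n R) : 'I_n -> R := fun i => coord t i.
have [delta deltaP] : exists delta, forall t, in_cube r (fam t) -> P (fam t) (delta t).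
  apply: (functional_choice (fun t d => in_cube r (fam t) -> P (fam t) d)) => t.
  have [ct|nct] := classic (in_cube r (fam t)); last by exists (mkposreal _ Rlt_0_1).
  by have [d] := locP _ ct; exists d.
have [d dP] := compactness_value n (vec n (fun=> (- r)%R)) (vec n (fun=> r)) delta.
exists d => x xc; pose f k := if insub k is Some i then x i else 0%R.
have fE (i : 'I_n) : coord (vec n f) i = x i by rewrite coord_vec // /f valK.
have : bounded_n n (vec n (fun=> (- r)%R)) (vec n (fun=> r)) (vec n f).
  apply/bounded_coord => i lt_in; rewrite -[i]/(nat_of_ord (Ordinal lt_in)) fE; exact: xc.
move=> /dP/NNPP[t [/bounded_coord tc [/close_coord xt dt]]].
exists (fam t), (delta t); split=> //; first by apply: deltaP => i; apply: tc.
by move=> i; rewrite -fE; apply: xt.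
Qed.

Section Miranda.
Variables (n : nat) (r : R) (F : ('I_n.+1 -> R) -> 'I_n.+1 -> R).
Hypothesis r_gt0 : (0 < r)%R.
Hypothesis F_cont : forall i x,
  @continuous (fct_UniformSpace 'I_n.+1 R_UniformSpace) R_UniformSpace
    (fun x => F x i) x.
Hypothesis F_low : forall x i, in_cube r x -> x i = (- r)%R -> (F x i <= 0)%R.
Hypothesis F_high : forall x i, in_cube r x -> x i = r -> (0 <= F x i)%R.

Implicit Types v w : {ffun 'I_n.+1 -> nat}.

Definition grid_point (N : nat) (v : {ffun 'I_n.+1 -> nat}) (i : 'I_n.+1) : R :=
  (- r + 2 * r * (INR (v i) / INR N.+1))%R.

(** On the two faces orthogonal to direction [i] the answer is imposed rather than
    read off from [F], whose coordinate [i] might vanish there. *)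
Definition low_at N (v : {ffun 'I_n.+1 -> nat}) (i : 'I_n.+1) : bool :=
  (v i == 0) || (v i != N.+1) && is_left (Rlt_dec (F (grid_point N v) i) 0).

Definition kuhn_label N v : nat := find (low_at N v) (enum 'I_n.+1).

Lemma kuhn_label_le N v : kuhn_label N v <= n.+1.
Proof. by rewrite -[X in _ <= X](size_enum_ord n.+1) find_size. Qed.

Lemma kuhn_label_low N v (i : 'I_n.+1) : v i = 0 -> kuhn_label N v <= i.
Proof.
move=> vi; rewrite leqNgt; apply/negP => /(before_find i).
by rewrite nth_ord_enum /low_at vi eqxx.
Qed.

Lemma kuhn_label_lt N v (i : 'I_n.+1) : kuhn_label N v = i -> low_at N v i.
Proof.
move=> lab; have : has (low_at N v) (enum 'I_n.+1).
  by rewrite has_find -/(kuhn_label N v) lab size_enum_ord.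
by move=> /(nth_find i); rewrite -/(kuhn_label N v) lab nth_ord_enum.
Qed.

Lemma kuhn_label_top N v (i : 'I_n.+1) : kuhn_label N v = n.+1 -> ~~ low_at N v i.
Proof.
move=> lab; have /(before_find i) : i < find (low_at N v) (enum 'I_n.+1).
  by rewrite -/(kuhn_label N v) lab.
by rewrite nth_ord_enum => ->.
Qed.

Lemma kuhn_label_high N v (i : 'I_n.+1) : v i = N.+1 -> kuhn_label N v != i.
Proof.
by move=> vi; apply/eqP => /kuhn_label_lt; rewrite /low_at vi eqxx.
Qed.

Lemma grid_point_cube N (v : {ffun 'I_n.+1 -> nat}) :
  (forall i, v i <= N.+1) -> in_cube r (grid_point N v).
Proof.
move=> vN i; rewrite /grid_point.
have N0 : (0 < INR N.+1)%R by apply: lt_0_INR; lia.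
have v0 := pos_INR (v i).
have vN' : (INR (v i) <= INR N.+1)%R by apply: le_INR; have := vN i; lia.
have q0 : (0 <= INR (v i) / INR N.+1)%R by apply: Rdiv_le_0_compat.
have q1 : (INR (v i) / INR N.+1 <= 1)%R by apply/Rle_div_l; lra.
nra.
Qed.

(** In a cell with all labels, the vertex with label [n.+1] makes every coordinate of
    [F] nonnegative, and the one with label [i] makes coordinate [i] nonpositive.
    Without a zero, this contradicts the constant strict sign of some coordinate on
    a ball containing the cell. *)
Lemma poincare_miranda_ord : exists2 x, in_cube r x & forall i, F x i = 0%R.
Proof.
apply: NNPP => no_zero.
(* The factor 2 leaves room for the cell: a vertex is within [e] of [t], and the
   others are within [d <= e] of that vertex. *)
pose P (t : 'I_n.+1 -> R) (e : posreal) := exists i,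
  (forall y, (forall j, Rabs (y j - t j) < 2 * e)%R -> (0 < F y i)%R) \/
  (forall y, (forall j, Rabs (y j - t j) < 2 * e)%R -> (F y i < 0)%R).
have locP x : in_cube r x -> exists d, P x d.
  move=> xc; have [i Fi] : exists i, F x i <> 0%R.
    apply: NNPP => all0; apply: no_zero; exists x => // i.
    by apply: NNPP => Fi; apply: all0; exists i.
  have half (e : posreal) : (2 * (e / 2) = e)%R by field.
  have [neg|pos] : (F x i < 0 \/ 0 < F x i)%R by lra.
    have [e eP] := @F_cont i x _ (open_lt 0%R _ neg).
    exists (pos_div_2 e), i; right => y yx; apply: eP => j.
    by move: (yx j); rewrite /= half.
  have [e eP] := @F_cont i x _ (open_gt 0%R _ pos).
  exists (pos_div_2 e), i; left => y yx; apply: eP => j.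
  by move: (yx j); rewrite /= half.
have [d dP] := lebesgue_number locP.
have [N Nd] : exists N, (2 * r / INR N.+1 < d)%R.
  have d2r : (0 < d / (2 * r))%R.
    by apply: Rdiv_lt_0_compat; [exact: cond_pos|lra].
  have [N [Nd N0]] := archimed_cor1 _ d2r; exists N.-1.
  rewrite prednK; last by apply/ltP.
  rewrite (_ : (d : R) = 2 * r * (d / (2 * r)))%R; last by field; lra.
  by apply: Rmult_lt_compat_l Nd; lra.
have [p pP] := Kuhn.kuhn_cell (@kuhn_label_le N) (@kuhn_label_low N) (@kuhn_label_high N).
have cell_cube (v : {ffun 'I_n.+1 -> nat}) : (forall i, p i <= v i <= (p i).+1) -> in_cube r (grid_point N v).
  move=> vp; apply: grid_point_cube => i.
  by have /andP[_ vi] := vp i; apply: leq_trans vi _; rewrite ltnS -ltnS.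
have cell_close (v w : {ffun 'I_n.+1 -> nat}) : (forall i, p i <= v i <= (p i).+1) ->
    (forall i, p i <= w i <= (p i).+1) ->
    forall j, (Rabs (grid_point N v j - grid_point N w j) < d)%R.
  move=> vp wp j; apply: Rle_lt_trans Nd; rewrite /grid_point.
  have N0 : (0 < INR N.+1)%R by apply: lt_0_INR; lia.
  have [/andP[/leP/le_INR v0 /leP/le_INR v1] /andP[/leP/le_INR w0 /leP/le_INR w1]] := (vp j, wp j).
  rewrite S_INR in v1; rewrite S_INR in w1.
  have -> : (- r + 2 * r * (INR (v j) / INR N.+1) - (- r + 2 * r * (INR (w j) / INR N.+1))
    = (2 * r / INR N.+1) * (INR (v j) - INR (w j)))%R by field; lra.
  have c0 : (0 < 2 * r / INR N.+1)%R by apply: Rdiv_lt_0_compat; lra.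
  rewrite Rabs_mult (Rabs_pos_eq (2 * r / _)); last lra.
  have : (Rabs (INR (v j) - INR (w j)) <= 1)%R by apply: Rabs_le; lra.
  by nra.
have [v vtop vp] := pP n.+1 (leqnn _).
have [t [e [[i sgn] vt de]]] := dP _ (cell_cube v vp).
have [w wi wp] := pP i (ltnW (ltn_ord i)).
have e0 := cond_pos e.
have v_near j : (Rabs (grid_point N v j - t j) < 2 * e)%R by have := vt j; lra.
have w_near j : (Rabs (grid_point N w j - t j) < 2 * e)%R.
  have := Rabs_triang (grid_point N w j - grid_point N v j) (grid_point N v j - t j).
  have := cell_close _ _ wp vp j; have := vt j.
  have -> : (grid_point N w j - grid_point N v j + (grid_point N v j - t j)
     = grid_point N w j - t j)%R by ring.
  lra.
have Fv : (0 <= F (grid_point N v) i)%R.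
  have := kuhn_label_top i vtop; rewrite /low_at negb_or negb_and negbK.
  case/andP=> _ /orP[/eqP vi|].
    apply: F_high; first exact: cell_cube.
    rewrite /grid_point vi; field; apply: not_0_INR; lia.
  by case: Rlt_dec => //= ? _; lra.
have Fw : (F (grid_point N w) i <= 0)%R.
  have := kuhn_label_lt wi; rewrite /low_at.
  case/orP=> [/eqP wi0|/andP[_]]; last by case: Rlt_dec => //= ? _; lra.
  apply: F_low; first exact: cell_cube.
  by rewrite /grid_point wi0 /=; lra.
by case: sgn => H; [have := H _ w_near | have := H _ v_near]; lra.
Qed.
End Miranda.

Theorem poincare_miranda (I : finType) (r : R) (F : (I -> R) -> I -> R) :
  (0 < r)%R ->
  (forall i x, @continuous (fct_UniformSpace I R_UniformSpace) R_UniformSpace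
     (fun x => F x i) x) ->
  (forall x i, in_cube r x -> x i = (- r)%R -> (F x i <= 0)%R) ->
  (forall x i, in_cube r x -> x i = r -> (0 <= F x i)%R) ->
  exists2 x, in_cube r x & forall i, F x i = 0%R.
Proof.
move=> r0 F_cont F_low F_high.
case card_I : #|I| => [|n].
  by exists (fun=> 0%R) => i; have := card0_eq card_I i; rewrite inE.
pose rk (i : I) : 'I_n.+1 := cast_ord card_I (enum_rank i).
pose un (k : 'I_n.+1) : I := enum_val (cast_ord (esym card_I) k).
have rkK : cancel rk un by move=> i; rewrite /un /rk cast_ordK enum_rankK.
have unK : cancel un rk by move=> k; rewrite /un /rk enum_valK cast_ordKV.
pose G (y : 'I_n.+1 -> R) k := F (fun i => y (rk i)) (un k).
have cube y : in_cube r y -> in_cube r (fun i => y (rk i)) by move=> yc i; apply: yc.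
have [||| y yc Gy] := @poincare_miranda_ord n r G r0.
- move=> k y; apply: (@continuous_comp (fct_UniformSpace 'I_n.+1 R_UniformSpace)
    (fct_UniformSpace I R_UniformSpace) R_UniformSpace
    (fun y i => y (rk i)) (fun x => F x (un k))); last exact: F_cont.
  move=> P [e eP]; exists e => z yz; apply: eP => i; exact: yz.
- by move=> y k yc yk; apply: F_low; [exact: cube|rewrite unK].
- by move=> y k yc yk; apply: F_high; [exact: cube|rewrite unK].
by exists (fun i => y (rk i)); [exact: cube|move=> i; rewrite -[i]rkK; apply: Gy].
Qed.
End Miranda.

(** * Periodic lattice fields *)

Lemma periodic_mul (A : Type) (n : Z) (f : Z -> A) :
  (forall z, f (z + n)%Z = f z) -> forall m z, f (z + m * n)%Z = f z.
Proof.
  intros f_per m; induction m using Z.peano_ind; intros z.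
  - f_equal; lia.
  - replace (z + Z.succ m * n)%Z with (z + m * n + n)%Z by lia.
    now rewrite f_per.
  - rewrite <- (f_per (z + Z.pred m * n)%Z).
    now replace (z + Z.pred m * n + n)%Z with (z + m * n)%Z by lia.
Qed.

Lemma periodic_mod (A : Type) (n : Z) (f : Z -> A) :
  n <> 0%Z -> (forall z, f (z + n)%Z = f z) -> forall z, f (z mod n)%Z = f z.
Proof.
  intros n0 f_per z.
  rewrite <- (periodic_mul A n f f_per (z / n) (z mod n)).
  f_equal; pose proof (Z.div_mod z n n0); lia.
Qed.

(** A uniform structure making continuous both the evaluation at a site and the
    extension of the values over one period to a periodic field. *)
Definition field_space : UniformSpace :=
  fct_UniformSpace Z (fct_UniformSpace Z C_UniformSpace).

Definition in_square (r : R) (z : C) : Prop :=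
  (- r <= fst z <= r)%R /\ (- r <= snd z <= r)%R.

(** The inequality that Poincare-Miranda needs from the value [y] when the coordinate
    [x] is at an end of [[-r, r]]. *)
Definition outward_at (r x y : R) : Prop :=
  (x = (- r)%R -> (y <= 0)%R) /\ (x = r -> (0 <= y)%R).

Module Lattice.
Import all_boot zify.
Delimit Scope R_scope with R.
Set Implicit Arguments. Unset Strict Implicit. Unset Printing Implicit Defensive.
Local Open Scope nat_scope.

Definition residue (n : nat) (z : Z) : 'I_n.+1 :=
  inord (Z.to_nat (z mod Z.of_nat n.+1)).

Lemma of_residue n z : Z.of_nat (residue n z) = (z mod Z.of_nat n.+1)%Z.
Proof.
have [lo hi] : (0 <= z mod Z.of_nat n.+1 < Z.of_nat n.+1)%Z by apply: Z.mod_pos_bound.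
rewrite inordK; first by rewrite Z2Nat.id.
by apply/ltP; lia.
Qed.

Lemma residue_periodic n z : residue n (z + Z.of_nat n.+1) = residue n z.
Proof. by rewrite /residue -(Z.mod_add z 1 (Z.of_nat n.+1)) // Z.mul_1_l. Qed.

Lemma residue_of_nat n (i : 'I_n.+1) : residue n (Z.of_nat i) = i.
Proof.
apply: ord_inj; apply: Nat2Z.inj; rewrite of_residue Z.mod_small //.
by have := ltn_ord i; lia.
Qed.

(** Poincare-Miranda in the real and imaginary parts over one period. Both
    periodicity and the equation [E phi = 0] then extend to the whole lattice. *)
Theorem lattice_miranda (T K : nat) (r : R) (E : (Z -> Z -> C) -> Z -> Z -> C) :
  T <> 0 -> K <> 0 -> (0 < r)%R ->
  (forall phi, periodic2 T K phi -> periodic2 T K (E phi)) ->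
  (forall t k phi, @continuous field_space C_UniformSpace (fun phi => E phi t k) phi) ->
  (forall phi t k, (forall s l, in_square r (phi s l)) ->
     outward_at r (fst (phi t k)) (fst (E phi t k)) /\
     outward_at r (snd (phi t k)) (snd (E phi t k))) ->
  exists phi, periodic2 T K phi /\ forall t k, E phi t k = RtoC 0.
Proof.
case: T K => [//|T] [//|K] _ _ r0 E_per E_cont E_out.
pose I : finType := ('I_T.+1 * 'I_K.+1 * bool)%type.
pose field (x : I -> R) (t k : Z) : C :=
  (x (residue T t, residue K k, false), x (residue T t, residue K k, true)).
pose part (b : bool) (z : C) : R := if b then snd z else fst z.
pose F (x : I -> R) (i : I) : R :=
  part i.2 (E (field x) (Z.of_nat i.1.1) (Z.of_nat i.1.2)).
have field_per x : periodic2 T.+1 K.+1 (field x).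
  by move=> t k; rewrite /field !residue_periodic.
have field_square x : Miranda.in_cube r x -> forall s l, in_square r (field x s l).
  by move=> xc s l; split; apply: xc.
have fieldE x (i : I) : part i.2 (field x (Z.of_nat i.1.1) (Z.of_nat i.1.2)) = x i.
  by case: i => [[a b] []]; rewrite /part /field /= !residue_of_nat.
have F_cont i x : @continuous (fct_UniformSpace I R_UniformSpace) R_UniformSpace
    (fun x => F x i) x.
  apply: (@continuous_comp (fct_UniformSpace I R_UniformSpace) C_UniformSpace
    R_UniformSpace (fun x => E (field x) (Z.of_nat i.1.1) (Z.of_nat i.1.2)) (part i.2)).
    apply: (@continuous_comp (fct_UniformSpace I R_UniformSpace) field_space
      C_UniformSpace field (fun phi => E phi (Z.of_nat i.1.1) (Z.of_nat i.1.2))).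
      by move=> P [e eP]; exists e => y xy; apply: eP => t k; split; apply: xy.
    exact: E_cont.
  move=> P [e eP]; exists e => y [xy1 xy2]; apply: eP.
  by rewrite /part; case: (i.2).
have F_out x i : Miranda.in_cube r x -> outward_at r (x i) (F x i).
  move=> /field_square xsq; rewrite -(fieldE x i) /F /part.
  by have [] := E_out _ (Z.of_nat i.1.1) (Z.of_nat i.1.2) xsq; case: (i.2).
have [x _ Fx] := Miranda.poincare_miranda r0 F_cont
  (fun x i xc => proj1 (F_out x i xc)) (fun x i xc => proj2 (F_out x i xc)).
exists (field x); split=> // t k.
have per := E_per _ (field_per x).
rewrite -(periodic_mod _ (Z.of_nat T.+1) (fun t => E (field x) t k)) //; last first.
  by move=> s; case: (per s k).
rewrite -(periodic_mod _ (Z.of_nat K.+1) (E (field x) _)) //; last first.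
  by move=> s; case: (per (t mod Z.of_nat T.+1)%Z s).
rewrite -!of_residue.
apply: injective_projections.
  exact: (Fx (residue T t, residue K k, false)).
exact: (Fx (residue T t, residue K k, true)).
Qed.
End Lattice.

(** * The nonlinear Schrodinger operator *)

Lemma continuous_Cmult (U : UniformSpace) (f h : U -> C) (x : U) :
  @continuous U C_UniformSpace f x -> @continuous U C_UniformSpace h x ->
  @continuous U C_UniformSpace (fun y => f y * h y) x.
Proof.
  intros f_cont h_cont P HP.
  apply (continuous_mult (K := C_AbsRing) f h x).
  - intros Q HQ; apply f_cont, locally_C, HQ.
  - intros Q HQ; apply h_cont, locally_C, HQ.
  - apply locally_C, HP.
Qed.

Lemma continuous_Cplus (U : UniformSpace) (f h : U -> C) (x : U) :
  @continuous U C_UniformSpace f x -> @continuous U C_UniformSpace h x ->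
  @continuous U C_UniformSpace (fun y => f y + h y) x.
Proof. exact (continuous_plus (V := C_NormedModule) f h x). Qed.

Lemma continuous_Cminus (U : UniformSpace) (f h : U -> C) (x : U) :
  @continuous U C_UniformSpace f x -> @continuous U C_UniformSpace h x ->
  @continuous U C_UniformSpace (fun y => f y - h y) x.
Proof. exact (continuous_minus (V := C_NormedModule) f h x). Qed.

Lemma continuous_RtoC_Cmod (U : UniformSpace) (f : U -> C) (x : U) :
  @continuous U C_UniformSpace f x ->
  @continuous U C_UniformSpace (fun y => RtoC (Cmod (f y))) x.
Proof.
  intros f_cont.
  apply (continuous_comp (V := R_UniformSpace) (fun y => Cmod (f y)) RtoC).
  - apply (continuous_comp (V := C_UniformSpace) f Cmod); [exact f_cont|].
    exact (filterlim_norm (V := C_NormedModule) (f x)).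
  - intros P [e eP]; exists e; intros y xy; apply eP.
    split; [exact xy | apply ball_center].
Qed.

Lemma continuous_site (t k : Z) (phi : field_space) :
  @continuous field_space C_UniformSpace (fun psi => psi t k) phi.
Proof. intros P [e eP]; exists e; intros psi near; apply eP, near. Qed.

(** By periodicity only finitely many times occur, so one threshold [M] serves all. *)
Lemma cubic_domination (T : nat) (g : Z -> C -> C) (delta : R) :
  T <> 0%nat -> (0 < delta)%R ->
  (forall t z, g (t + Z.of_nat T)%Z z = g t z) ->
  (forall t, filterlim (fun z => g t z / RtoC (Cmod z ^ 3)%R) Cmod_infty
       (locally (RtoC 0))) ->
  exists M : R, forall t z, (M < Cmod z)%R -> (Cmod (g t z) <= delta * Cmod z ^ 3)%R.
Proof.
  intros T0 delta0 g_per g_lim.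
  assert (each : forall t, exists M : R, forall z,
             (M < Cmod z)%R -> (Cmod (g t z) <= delta * Cmod z ^ 3)%R).
  { intros t.
    destruct (g_lim t (fun w => (Cmod w < delta)%R)) as [M HM].
    - apply locally_C; exists (mkposreal _ delta0); intros w near.
      change (Cmod (w - 0) < delta)%R in near.
      revert near; generalize (w : C); clear w; intros w near.
      now replace (w - 0) with w in near by ring.
    - exists (Rmax 0 M); intros z Hz.
      pose proof (Rmax_l 0 M); pose proof (Rmax_r 0 M).
      assert (pos : (0 < Cmod z ^ 3)%R) by (apply pow_lt; lra).
      specialize (HM z ltac:(lra)); simpl in HM.
      rewrite Cmod_div, Cmod_R, Rabs_pos_eq in HM by (try (intros e; apply RtoC_inj in e); simpl in *; lra).
      apply Rlt_le, Rlt_div_l; assumption. }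
  assert (finitely_many : forall n, exists M : R, forall i z, (i < n)%nat ->
             (M < Cmod z)%R -> (Cmod (g (Z.of_nat i) z) <= delta * Cmod z ^ 3)%R).
  { induction n as [|n [M HM]]; [exists 0%R; lia|].
    destruct (each (Z.of_nat n)) as [M' HM'].
    exists (Rmax M M'); intros i z i_lt Hz.
    pose proof (Rmax_l M M'); pose proof (Rmax_r M M').
    assert (i_cases : (i < n)%nat \/ i = n) by lia.
    destruct i_cases as [i_lt' | ->]; [apply HM | apply HM']; (assumption || lra). }
  destruct (finitely_many T) as [M HM]; exists M; intros t z Hz.
  rewrite <- (periodic_mod _ (Z.of_nat T) (fun s => g s z)) by (try lia; auto).
  pose proof (Z.mod_pos_bound t (Z.of_nat T) ltac:(lia)) as bound.
  rewrite <- (Z2Nat.id (t mod Z.of_nat T)) by lia.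
  apply HM; [lia | assumption].
Qed.

Lemma Cmod_in_square (r : R) (z : C) : in_square r z -> (Cmod z <= 2 * r)%R.
Proof.
  intros [[re1 re2] [im1 im2]].
  rewrite <- (Rabs_pos_eq (2 * r)) by lra.
  unfold Cmod; rewrite <- sqrt_Rsqr_abs; apply sqrt_le_1_alt; unfold Rsqr; nra.
Qed.

Lemma outward_of_dominated (r a x y : R) :
  (0 < r)%R -> ((r <= Rabs x)%R -> (Rabs y <= a * r)%R) -> outward_at r x (a * x + y).
Proof.
  intros r0 y_le.
  split; intros ->; [rewrite Rabs_Ropp in y_le|];
    rewrite Rabs_pos_eq in y_le by lra; specialize (y_le (Rle_refl r));
    pose proof (Rle_abs y); pose proof (Rle_abs (- y)); rewrite Rabs_Ropp in *; lra.
Qed.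

Definition hopping (beta epsilon : R) (phi : Z -> Z -> C) (t k : Z) : C :=
  Ci * RtoC beta * (phi (t + 1)%Z k - phi (t - 1)%Z k)
  + RtoC epsilon * (phi t (k + 1)%Z - RtoC 2 * phi t k + phi t (k - 1)%Z).

Lemma Cmod_hopping (beta epsilon r : R) (phi : Z -> Z -> C) (t k : Z) :
  (0 < beta)%R -> (0 < epsilon)%R -> (forall s l, in_square r (phi s l)) ->
  (Cmod (hopping beta epsilon phi t k) <= (4 * beta + 8 * epsilon) * r)%R.
Proof.
  intros beta0 epsilon0 sq; unfold hopping, Cminus.
  assert (le2r : forall s l, (Cmod (phi s l) <= 2 * r)%R)
    by (intros; apply Cmod_in_square, sq).
  eapply Rle_trans; [apply Cmod_triangle|]; rewrite !Cmod_mult, Cmod_Ci, !Cmod_R.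
  rewrite (Rabs_pos_eq beta), (Rabs_pos_eq epsilon) by lra.
  pose proof (le2r (t + 1)%Z k); pose proof (le2r (t - 1)%Z k).
  pose proof (le2r t (k + 1)%Z); pose proof (le2r t (k - 1)%Z); pose proof (le2r t k).
  assert (time : (Cmod (phi (t + 1)%Z k + - phi (t - 1)%Z k) <= 4 * r)%R).
  { eapply Rle_trans; [apply Cmod_triangle|]; rewrite Cmod_opp; lra. }
  assert (space : (Cmod (phi t (k + 1)%Z + - (RtoC 2 * phi t k) + phi t (k - 1)%Z)
                   <= 8 * r)%R).
  { eapply Rle_trans; [apply Cmod_triangle|].
    eapply Rle_trans; [apply Rplus_le_compat_r, Cmod_triangle|].
    rewrite Cmod_opp, Cmod_mult, Cmod_R, (Rabs_pos_eq 2) by lra; lra. }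
  nra.
Qed.

Theorem theorem2p5
  (T K : nat) (HT : (1 <= T)%nat) (HK : (2 <= K)%nat)
  (beta epsilon gamma : R)
  (Hbeta : (0 < beta)%R) (Hepsilon : (0 < epsilon)%R) (Hgamma : gamma <> 0%R)
  (g : Z -> C -> C)
  (g_cont : forall (t : Z) (z : C), continuous (g t) z)
  (g_per : forall (t : Z) (z : C), g (t + Z.of_nat T)%Z z = g t z)
  (g_lim : forall t : Z,
     filterlim (fun z : C => g t z / RtoC (Cmod z ^ 3)%R) Cmod_infty
       (locally (RtoC 0))) :
  exists phi : Z -> Z -> C,
    periodic2 T K phi /\
    forall t k : Z,
      Ci * RtoC beta * (Delta_t phi t k + nabla_t phi t k)
      + RtoC gamma * RtoC (Cmod (phi t k) ^ 2)%R * phi t k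
      + RtoC epsilon * Delta_k (Delta_k phi) t (k - 1)%Z
      = g t (phi t k).
Proof.
  pose (coupling := fun (phi : Z -> Z -> C) (t k : Z) =>
    hopping beta epsilon phi t k - g t (phi t k)).
  (* Multiplying by [gamma] makes the cubic coefficient positive. *)
  pose (E := fun phi t k => RtoC gamma *
    (RtoC gamma * RtoC (Cmod (phi t k)) * RtoC (Cmod (phi t k)) * phi t k
     + coupling phi t k)).
  assert (gamma_pos : (0 < Rabs gamma)%R) by now apply Rabs_pos_lt.
  destruct (cubic_domination T g (Rabs gamma / 4)) as [M HM];
    [lia | lra | exact g_per | exact g_lim |].
  pose (c := (4 * beta + 8 * epsilon)%R).
  assert (c_pos : (0 < c)%R) by (unfold c; lra).
  (* [r > M] is for the bound on [g]; the last summand and [r >= 1] make half of the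
     cubic term absorb the linear terms, while [g] takes the other half. *)
  pose (r := (1 + Rabs M + 2 * c / Rabs gamma)%R).
  assert (r_c : (2 * c <= r * Rabs gamma)%R).
  { unfold r; replace (2 * c)%R with (2 * c / Rabs gamma * Rabs gamma)%R at 1 by (field; lra).
    pose proof (Rabs_pos M); nra. }
  assert (r_big : (1 <= r /\ M < r)%R).
  { pose proof (Rabs_pos M); pose proof (Rle_abs M).
    assert (0 < 2 * c / Rabs gamma)%R by (apply Rdiv_lt_0_compat; lra).
    unfold r; lra. }
  assert (small : forall phi t k, (forall s l, in_square r (phi s l)) ->
      (r <= Cmod (phi t k))%R ->
      (Cmod (RtoC gamma * coupling phi t k) <= gamma ^ 2 * Cmod (phi t k) ^ 2 * r)%R).
  { intros phi t k sq far.
    set (q := Cmod (phi t k)) in *.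
    assert (coupling_le : (Cmod (coupling phi t k) <= c * r + Rabs gamma / 4 * q ^ 3)%R).
    { unfold coupling, Cminus.
      eapply Rle_trans; [apply Cmod_triangle|]; rewrite Cmod_opp.
      apply Rplus_le_compat; [now apply Cmod_hopping | apply HM; fold q; lra]. }
    rewrite Cmod_mult, Cmod_R, <- (pow2_abs gamma).
    assert (q_le : (q <= 2 * r)%R) by apply Cmod_in_square, sq.
    assert (cube : (q ^ 3 <= 2 * r * q ^ 2)%R) by nra.
    assert (square : (r <= q ^ 2)%R) by nra.
    assert (linear : (2 * c * r <= Rabs gamma * q ^ 2 * r)%R).
    { apply Rmult_le_compat_r; nra. }
    replace (Rabs gamma ^ 2 * q ^ 2 * r)%R
      with (Rabs gamma * (Rabs gamma * q ^ 2 * r))%R by ring.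
    apply Rmult_le_compat_l; [lra|]; nra. }
  destruct (@Lattice.lattice_miranda T K r E) as [phi [phi_per phi_zero]];
    [lia | lia | lra | | | |].
  - intros phi phi_per t k; unfold E, coupling, hopping.
    replace (t + Z.of_nat T + 1)%Z with (t + 1 + Z.of_nat T)%Z by lia.
    replace (t + Z.of_nat T - 1)%Z with (t - 1 + Z.of_nat T)%Z by lia.
    replace (k + Z.of_nat K + 1)%Z with (k + 1 + Z.of_nat K)%Z by lia.
    replace (k + Z.of_nat K - 1)%Z with (k - 1 + Z.of_nat K)%Z by lia.
    assert (per_t : forall s l, phi (s + Z.of_nat T)%Z l = phi s l)
      by (intros; apply phi_per).
    assert (per_k : forall s l, phi s (l + Z.of_nat K)%Z = phi s l)
      by (intros; apply phi_per).
    now rewrite !per_t, !per_k, g_per.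
  - intros t k phi; unfold E, coupling, hopping.
    repeat lazymatch goal with
      | |- continuous (fun psi => Cplus (@?f psi) (@?h psi)) _ =>
          apply (continuous_Cplus field_space f h)
      | |- continuous (fun psi => Cminus (@?f psi) (@?h psi)) _ =>
          apply (continuous_Cminus field_space f h)
      | |- continuous (fun psi => Cmult (@?f psi) (@?h psi)) _ =>
          apply (continuous_Cmult field_space f h)
      | |- continuous (fun psi => RtoC (Cmod (@?f psi))) _ =>
          apply (continuous_RtoC_Cmod field_space f)
      | |- continuous (fun psi => psi _ _) _ => apply continuous_site
      | |- continuous (fun _ => ?a) _ => apply continuous_const
      end.
    apply (continuous_comp (fun psi : field_space => psi t k) (g t));
      [apply continuous_site | apply g_cont].
  - intros phi t k sq.
    pose proof (small phi t k sq) as dominated.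
    pose proof (Rmax_Cmod (RtoC gamma * coupling phi t k)) as w_le.
    pose proof (Rmax_Cmod (phi t k)) as parts_le.
    set (q := Cmod (phi t k)) in *.
    set (w := RtoC gamma * coupling phi t k) in *.
    replace (E phi t k) with (RtoC (gamma ^ 2 * q ^ 2) * phi t k + w)
      by (unfold E, w; fold q; rewrite RtoC_mult, !RtoC_pow; ring).
    assert (fst_E : fst (RtoC (gamma ^ 2 * q ^ 2) * phi t k + w)
                    = (gamma ^ 2 * q ^ 2 * fst (phi t k) + fst w)%R) by (simpl; ring).
    assert (snd_E : snd (RtoC (gamma ^ 2 * q ^ 2) * phi t k + w)
                    = (gamma ^ 2 * q ^ 2 * snd (phi t k) + snd w)%R) by (simpl; ring).
    pose proof (Rmax_l (Rabs (fst (phi t k))) (Rabs (snd (phi t k)))).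
    pose proof (Rmax_r (Rabs (fst (phi t k))) (Rabs (snd (phi t k)))).
    pose proof (Rmax_l (Rabs (fst w)) (Rabs (snd w))).
    pose proof (Rmax_r (Rabs (fst w)) (Rabs (snd w))).
    rewrite fst_E, snd_E; split; apply outward_of_dominated;
      try lra; intros far; specialize (dominated ltac:(lra)); lra.
  - exists phi; split; [exact phi_per|]; intros t k.
    specialize (phi_zero t k); unfold E, coupling, hopping in phi_zero.
    apply (f_equal (Cmult (/ RtoC gamma))) in phi_zero.
    rewrite Cmult_assoc, Cinv_l, Cmult_1_l, Cmult_0_r in phi_zero
      by (intros gamma0; now apply RtoC_inj in gamma0).
    unfold Delta_t, nabla_t, Delta_k.
    replace (k - 1 + 1)%Z with k by lia.
    rewrite RtoC_pow.
    rewrite <- (Cplus_0_r (g t (phi t k))), <- phi_zero; ring.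
Qed.
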